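(* For $n=2,3,4,5,6,7,8$, the diameter of the Cayley graph of the group $G_n$ of the $n$-order two-dimensional magic cube, with respect to the generating set $X=\{V_i^j,\ H_i^j : 1\le i\le n,\ 1\le j\le n-1\}$, is at least $3,6,11,18,26,36,48$, respectively.
   Context: Let $B_n=\{1,2,\dots,n^2\}$ be the set of positions of an $n\times n$ board, the position in row $x$ and column $y$ having number $\varphi(x,y)=n(x-1)+y$. Permutations act on the right and are composed from left to right. For $1\le i\le n$ and $j\in\mathbb{Z}$, $$V_i^j=\bigl(\varphi(n,i)\ \varphi(n-1,i)\ \cdots\ \varphi(1,i)\bigr)^j,\qquad H_i^j=\bigl(\varphi(i,n)\ \varphi(i,n-1)\ \cdots\ \varphi(i,1)\bigr)^j,$$ i.e. cyclic shifts by $j$ steps of column $i$ (upwards) and of row $i$ (leftwards). $G_n$ is the group of permutations of $B_n$ generated by all these elements. The Cayley graph of a group $G$ with respect to a generating set $X$ has vertex set $G$, and $x,y\in G$ are joined by an edge if and only if $y=gx$ or $x=gy$ for some $g\in X$. The diameter of a connected graph is the maximum distance between two vertices. *)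

(* Defs.v *)
From mathcomp Require Import all_boot all_fingroup.

Set Implicit Arguments.
Unset Strict Implicit.
Unset Printing Implicit Defensive.

Section GraphDistance.

Variables (T : finType) (e : rel T).

Definition walk (x y : T) (k : nat) : bool :=
  [exists p : k.-tuple T, path e x p && (last x p == y)].

Lemma walk_exists (x y : T) : connect e x y -> exists k, walk x y k.
Proof.
case/connectP=> p ep ->; exists (size p).
by apply/existsP; exists (in_tuple p); rewrite /= ep eqxx.
Qed.

(* Pairs of vertices not joined by a walk get the value 0, so that they never
   contribute to the diameter. *)
Definition gdist (x y : T) : nat :=
  if @idP (connect e x y) is ReflectT exy then ex_minn (walk_exists exy) else 0.

Definition diameter : nat := \max_(x : T) \max_(y : T) gdist x y.

End GraphDistance.

(* The vertices are the elements of the group G, seen as the type [subg G]. *)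
Definition cayley (gT : finGroupType) (G : {group gT}) (X : {set gT}) :
    rel (subg_of G) :=
  fun x y => [exists g in X,
    (sgval y == (g * sgval x)%g) || (sgval x == (g * sgval y)%g)].
Arguments cayley {gT} G X.

(* The cycle (s_0 s_1 ... s_k), mapping each s_i to s_(i+1) and s_k to s_0. *)
Definition cycle_perm (T : finType) (s : seq T) (us : uniq s) : {perm T} :=
  perm (can_inj (prev_next us)).

Section Magic.

Variable n : nat.

(* Rows, columns and positions are numbered from 0 instead of 1, so that
   n (x - 1) + y becomes n x + y. *)
Definition board := 'I_(n ^ 2).

Lemma pos_subproof (x y : 'I_n) : n * x + y < n ^ 2.
Proof.
apply: (@leq_trans (n * x.+1)); first by rewrite mulnS addnC ltn_add2r.
by rewrite expnS expn1 leq_mul2l ltn_ord orbT.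
Qed.

Definition pos (x y : 'I_n) : board := Ordinal (pos_subproof x y).

Lemma pos_inj (x y x' y' : 'I_n) : pos x y = pos x' y' -> x = x' /\ y = y'.
Proof.
move=> /(congr1 val) /= E; have n_gt0 : 0 < n by apply: leq_trans (ltn_ord x).
split; apply: val_inj => /=.
  move/(congr1 (divn^~ n)): E.
  by rewrite ![n * _]mulnC !divnMDl // !divn_small ?ltn_ord // !addn0.
move/(congr1 (modn^~ n)): E.
by rewrite ![n * _]mulnC !modnMDl !modn_small ?ltn_ord.
Qed.

Definition col_seq (i : 'I_n) : seq board :=
  [seq pos x i | x <- rev (enum 'I_n)].
Definition row_seq (i : 'I_n) : seq board :=
  [seq pos i y | y <- rev (enum 'I_n)].

Lemma col_seq_uniq (i : 'I_n) : uniq (col_seq i).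
Proof.
rewrite map_inj_uniq ?rev_uniq ?enum_uniq // => x x' E.
by have [] := pos_inj E.
Qed.

Lemma row_seq_uniq (i : 'I_n) : uniq (row_seq i).
Proof.
rewrite map_inj_uniq ?rev_uniq ?enum_uniq // => y y' E.
by have [] := pos_inj E.
Qed.

Definition V (i : 'I_n) : {perm board} := cycle_perm (col_seq_uniq i).
Definition H (i : 'I_n) : {perm board} := cycle_perm (row_seq_uniq i).

(* <[V i]> and <[H i]> are the sets of all integer powers of V i and H i. *)
Definition magic_group : {group {perm board}} :=
  <<\bigcup_(i : 'I_n) (<[V i]> :|: <[H i]>)>>%G.

(* j : 'I_n with 0 < j ranges over 1, ..., n - 1. *)
Definition magic_gens : {set {perm board}} :=
  [set g | [exists i : 'I_n, exists j : 'I_n,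
     (0 < j) && ((g == (V i ^+ j)%g) || (g == (H i ^+ j)%g))]].

End Magic.

Local Open Scope group_scope.

Lemma magic_gens_generate (n : nat) :
  (1 < n)%N -> <<magic_gens n>> = magic_group n.
Proof.
move=> n_gt1; pose j1 : 'I_n := Ordinal n_gt1.
apply/eqP; rewrite eqEsubset !gen_subG; apply/andP; split.
  apply/subsetP=> g; rewrite inE => /existsP[i /existsP[j /andP[_ Eg]]].
  apply: mem_gen; apply/bigcupP; exists i; rewrite // inE.
  by case/orP: Eg => /eqP->; rewrite mem_cycle ?orbT.
apply/bigcupsP=> i _; rewrite subUset !cycle_subG.
by apply/andP; split; apply: mem_gen; rewrite inE; apply/existsP; exists i;
  apply/existsP; exists j1; rewrite /= expg1 eqxx ?orbT.
Qed.

Lemma cayley_connected (gT : finGroupType) (G : {group gT}) (X : {set gT}) :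
  <<X>> = G -> forall x y : subg_of G, connect (cayley G X) x y.
Proof.
move=> defG x y.
have symc : connect_sym (cayley G X).
  apply: sym_connect_sym => u v; apply: eq_existsb => g.
  by rewrite orbC.
have sXG : X \subset G by rewrite -defG subset_gen.
suff c1 z : connect (cayley G X) 1 z.
  by apply: (connect_trans _ (c1 y)); rewrite symc.
have: sgval z \in <<X>> by rewrite defG subgP.
case/gen_prodgP=> k [c Xc Ez].
suff: forall w : subg_of G, sgval w = \prod_(i < k) c i ->
    connect (cayley G X) 1 w.
  by apply.
move: Xc {z Ez}; elim: k c => [|k IHk] c Xc w.
  by rewrite big_ord0 => E; rewrite (_ : w = 1) //; apply: val_inj.
rewrite big_ord_recl => E.
set p := \prod_(i < k) _ in E.
have Gp : p \in G by apply: group_prod => i _; apply: (subsetP sXG).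
apply: (@connect_trans _ _ (subg G p)); last first.
  apply: connect1; apply/existsP; exists (c ord0).
  by rewrite Xc subgK // E eqxx.
by apply: (IHk (fun i => c (lift ord0 i))); rewrite // subgK.
Qed.

(* Main.v *)
Require Import Defs.
From Stdlib Require Import NArith Lia.
From mathcomp Require Import all_boot all_fingroup all_solvable.

Set Implicit Arguments.
Unset Strict Implicit.
Unset Printing Implicit Defensive.

(** The bounds come from counting: if k is the diameter, every element of the
group is a product of at most k generators, so a bound on the number of such
products that falls below the order of the group forces the diameter above k.

The order. The commutator of a row shift and a column shift is a 3-cycle, as
the two lines meet in one position ([commg_three_cycle]). Two of its three
points can be kept fixed while the third is carried by row and column shifts
to any other position, and the 3-cycles so obtained generate the alternating
group ([Alt_sub_three_cycles], [Alt_sub_magic]). When n is even a single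
column shift is odd, so the group is the full symmetric group; hence
(n ^ 2)! <= (odd n).+1 * #|G| for all n > 1 ([card_magic_group]). The factor 2
cannot be given away for even n: with it the counts for n = 2 and n = 8 would
no longer suffice.

The number of short products. The column shifts commute with one another, and
so do the row shifts. Gathering adjacent factors of the same kind turns a
product of at most k generators into an alternating product of column blocks
and row blocks, where a block that moves exactly w lines counts for w, and the
total is at most k ([ball_mull]). There are at most
d w = 'C(n, w) * (n - 1) ^ w blocks that move w lines. Thus the alternating
products of total m that start with a block of a given kind number at most a m,
where a 0 = 1 and a m is the sum of d w * a (m - w) over 1 <= w <= m, and the
products of at most k generators number at most 1 + 2 (a 1 + ... + a k)
([card_words], [card_ball]). These numbers are evaluated in binary, for the
factorial of 64 is out of reach in unary. *)

(** * Cyclic permutations *)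

Section CyclePerm.

Variables (T : finType) (s : seq T) (us : uniq s).

Lemma cycle_permE x : cycle_perm us x = next s x.
Proof. by rewrite permE. Qed.

Lemma cycle_perm_out x : x \notin s -> cycle_perm us x = x.
Proof. by move=> /negPf xs; rewrite cycle_permE next_nth xs. Qed.

Lemma cycle_perm_on : perm_on [set x in s] (cycle_perm us).
Proof.
by apply/subsetP => x; rewrite !inE; apply: contraR => /cycle_perm_out ->.
Qed.

Lemma fcycle_cycle_perm : fcycle (cycle_perm us) s.
Proof.
have := cycle_next us; rewrite (@eq_cycle _ _ (frel (cycle_perm us))) //.
by move=> x y /=; rewrite cycle_permE.
Qed.

Lemma cycle_perm_trans x y :
  x \in s -> y \in s -> exists k, (cycle_perm us ^+ k)%g x = y.
Proof.
move=> xs ys; exists (findex (cycle_perm us) x y).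
by rewrite permX iter_findex // (fconnect_cycle fcycle_cycle_perm xs).
Qed.

Lemma card_cycle_perm : 0 < size s -> #|<[cycle_perm us]>%g| <= size s.
Proof.
move=> s_gt0; apply: dvdn_leq => //; rewrite -[#|_|]/(#[_]%g) order_dvdn.
apply/eqP/permP => x; rewrite permX perm1.
have [xs|xs] := boolP (x \in s); last first.
  by apply: iter_fix; apply: cycle_perm_out.
rewrite -{1}(order_cycle fcycle_cycle_perm us xs).
by apply: (iter_order_cycle fcycle_cycle_perm).
Qed.

End CyclePerm.

(** (x y s_1 ... s_k) is (y s_1 ... s_k) followed by the transposition (x y). *)
Lemma odd_cycle_perm (T : finType) (s : seq T) (us : uniq s) :
  odd_perm (cycle_perm us) = odd (size s).-1.
Proof.
case: s us => [|x s] us.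
  suff -> : cycle_perm us = 1%g by rewrite odd_perm1.
  by apply/permP => x; rewrite cycle_permE perm1.
elim: s x us => [|y s IHs] x us.
  suff -> : cycle_perm us = 1%g by rewrite odd_perm1.
  apply/permP => z; rewrite cycle_permE perm1 /=.
  by case: eqP.
have uys : uniq (y :: s) by case/andP: us.
(* [next_at z y0 w s] is [y0] if z is last, the element after z if there is one,
   and z itself if z does not occur. The transposition moves only the first of
   these values; the condition on z excludes that y is returned as the third. *)
have nexts : {in [pred z | z != x], forall z w,
   (z != y) || (w == y) -> x \notin s -> y \notin s ->
   tperm x y (next_at z y w s) = next_at z x w s}.
  elim: s {IHs us uys} => [|a s IHs] z /=; rewrite inE => zx w.
    have [-> _ _ _|zw] := eqVneq z w; first by rewrite tpermR.
    have [zy|zy] := eqVneq z y; last by rewrite tpermD // eq_sym.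
    by rewrite zy in zw * => /= /eqP wy; rewrite wy eqxx in zw.
  rewrite !inE !negb_or => zyw /andP[xa xs] /andP[ya ys].
  have [_|zw] := eqVneq z w; first by rewrite tpermD.
  apply: IHs => //; move: zyw; case: (eqVneq z y) => //= zy /eqP wy.
  by rewrite zy wy eqxx in zw.
have xy : x != y by move: us; rewrite /= inE negb_or; case: eqP.
have -> : cycle_perm us = (cycle_perm uys * tperm x y)%g.
  apply/permP => z; rewrite permM !cycle_permE /=.
  move: us; rewrite /= inE negb_or => /andP[/andP[_ xs] /andP[ys _]].
  have [->|zx] := eqVneq z x; last first.
    by rewrite nexts ?inE // eqxx orbT.
  rewrite -[next_at x y y s]/(next (y :: s) x) next_nth inE.
  by rewrite (negPf xy) (negPf xs) tpermL.
by rewrite odd_permM (IHs y) odd_tperm xy addbT.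
Qed.

(** * Subgroups of the symmetric group that contain 3-cycles *)

Section ThreeCycles.

Local Open Scope group_scope.

Variables (T : finType) (G : {group {perm T}}) (x y : T).
Hypothesis xy : x != y.
Hypothesis G3 :
  forall z, z != x -> z != y -> tperm x y * tperm x z \in G.

(** Conjugation by the transposition (x y) inverts each of the given 3-cycles,
so it normalises the subgroup K that they generate. With (x y), K generates all
(x z), hence the symmetric group, so K has index at most 2. *)
Lemma Alt_sub_three_cycles : 'Alt_T \subset G.
Proof.
pose X := [set tperm x y * tperm x z | z in ~: [set x; y]].
have sXG : <<X>> \subset G.
  rewrite gen_subG; apply/subsetP => _ /imsetP[z + ->].
  by rewrite !inE negb_or => /andP[zx zy]; apply: G3.
have sXA : <<X>> \subset 'Alt_T.
  rewrite gen_subG; apply/subsetP => _ /imsetP[z + ->].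
  rewrite Alt_even !inE negb_or => /andP[zx zy].
  by rewrite odd_permM !odd_tperm xy eq_sym zx.
have nXt : tperm x y \in 'N(<<X>>).
  rewrite inE -genJ gen_subG; apply/subsetP => _ /imsetP[u Xu ->].
  case/imsetP: (Xu) => z _ Eu.
  suff -> : u ^ tperm x y = u^-1 by rewrite groupV mem_gen.
  by rewrite Eu conjgE invMg !tpermV !mulgA tperm2 mul1g.
have symXt : 'Sym_T \subset <<X>> * <[tperm x y]>.
  rewrite -norm_joinEr ?cycle_subG // /Sym -(gen_tperm x) gen_subG.
  apply/subsetP => _ /imsetP[z _ ->].
  have Kt : tperm x y \in <<X>> <*> <[tperm x y]>.
    by rewrite mem_gen // inE cycle_id orbT.
  have [->|zx] := eqVneq z x; first by rewrite tperm1 group1.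
  have [->//|zy] := eqVneq z y.
  rewrite -(groupMl _ Kt) mem_gen // inE mem_gen //.
  by apply/imsetP; exists z; rewrite // !inE negb_or zx.
have o2 : (#[tperm x y] <= 2)%N.
  by apply: dvdn_leq => //; rewrite order_dvdn expgS expg1 tperm2.
have T_gt1 : (1 < #|T|)%N.
  have <- : #|[set x; y]| = 2 by rewrite cards2 xy.
  by rewrite -cardsT subset_leq_card ?subsetT.
suff ge2 : (#|'Alt_T| <= #|<<X>>|)%N.
  suff -> : 'Alt_T = <<X>> by [].
  by apply/eqP; rewrite eq_sym eqEcard sXA.
rewrite -(leq_pmul2l (isT : 0 < 2)%N) card_Alt // -card_Sym.
apply: leq_trans (subset_leq_card symXt) _.
rewrite mulnC; apply: (@leq_trans (#|<<X>>| * #[tperm x y])%N).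
  by rewrite mul_cardG leq_pmulr ?cardG_gt0.
by rewrite leq_mul2l o2 orbT.
Qed.

End ThreeCycles.

Lemma card_ge_Alt_odd (T : finType) (G : {group {perm T}}) :
  ('Alt_T \subset G)%g -> (exists2 g, g \in G & odd_perm g) -> #|T|`! <= #|G|.
Proof.
move=> sAG [g Gg odd_g].
have [T_le1|T_gt1] := leqP #|T| 1.
  by case: #|T| T_le1 => [|[|//]] _; rewrite cardG_gt0.
rewrite -card_Alt // -(Lagrange sAG) mulnC leq_mul2l indexg_gt1.
apply/orP; right; apply/negP => /subsetP/(_ g Gg).
by rewrite Alt_even odd_g.
Qed.

Section CommutatorThreeCycle.

Local Open Scope group_scope.

(** On the support of s the permutation t agrees with the transposition
(p, t p), so s has the same conjugate under both, and the commutator is the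
product of two transpositions that share the point t p. *)
Lemma commg_three_cycle (T : finType) (A B : {set T}) (s t : {perm T}) (p : T) :
    perm_on A s -> perm_on B t -> A :&: B \subset [set p] ->
    s p != p -> t p != p ->
  [~ s, t] = tperm p (t p) * tperm p (s p).
Proof.
move=> sA tB AB spN tpN; set q := s p; set r := t p.
have qA : q \in A by rewrite perm_closed // (subsetP sA).
have rB : r \in B by rewrite perm_closed // (subsetP tB).
have ABp z : z \in A -> z \in B -> z = p.
  by move=> zA zB; apply/set1P/(subsetP AB)/setIP.
have rA : r \notin A by apply: contra tpN => rA; rewrite -/r (ABp r).
have qr : q != r by apply: contraNneq rA => <-.
have ut : perm_on (~: A) (t * tperm p r).
  apply/subsetP => z; rewrite !inE permM; apply: contra => zA; apply/eqP.
  have [->|zp] := eqVneq z p; first by rewrite tpermR.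
  have zB : z \notin B by apply: contra zp => zB; rewrite (ABp z).
  rewrite (out_perm tB zB) tpermD // 1?eq_sym //.
  by apply: contraNneq rA => <-.
have st : s ^ t = s ^ tperm p r.
  have : commute s (t * tperm p r).
    by apply: (perm_onC sA ut); rewrite disjoints_subset setCK.
  move/commgP/conjg_fixP; rewrite conjgM => E.
  by rewrite -{2}E -!conjgM -mulgA tperm2 mulg1.
rewrite commgEl st -commgEl commgEr tpermV tpermJ.
have tq : tperm p r q = q by rewrite tpermD // eq_sym.
by rewrite (out_perm sA rA) -/q conjgC tpermJ tpermR tq [tperm q p]tpermC.
Qed.

End CommutatorThreeCycle.

(** * The order of the magic cube group *)

Section MagicGroup.

Variable n : nat.

Lemma mem_col_seq (i x j : 'I_n) : (pos x j \in col_seq i) = (j == i).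
Proof.
apply/mapP/eqP => [[x' _ /pos_inj[_ ->]] // | ->].
by exists x; rewrite // mem_rev mem_enum.
Qed.

Lemma mem_row_seq (i x j : 'I_n) : (pos x j \in row_seq i) = (x == i).
Proof.
apply/mapP/eqP => [[y' _ /pos_inj[-> _]] // | ->].
by exists j; rewrite // mem_rev mem_enum.
Qed.

Lemma posP (p : board n) : exists x y, p = pos x y.
Proof.
have n_gt0 : 0 < n by case: n p => [[]|].
have x_lt : p %/ n < n by rewrite ltn_divLR // -expnSr.
exists (Ordinal x_lt), (Ordinal (ltn_pmod p n_gt0)).
by apply: val_inj; rewrite /= mulnC -divn_eq.
Qed.

Lemma size_col_seq (i : 'I_n) : size (col_seq i) = n.
Proof. by rewrite size_map size_rev size_enum_ord. Qed.

Lemma size_row_seq (i : 'I_n) : size (row_seq i) = n.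
Proof. by rewrite size_map size_rev size_enum_ord. Qed.

Lemma V_magic (i : 'I_n) : V i \in magic_group n.
Proof.
by apply: mem_gen; apply/bigcupP; exists i; rewrite // inE cycle_id.
Qed.

Lemma H_magic (i : 'I_n) : H i \in magic_group n.
Proof.
by apply: mem_gen; apply/bigcupP; exists i; rewrite // inE cycle_id orbT.
Qed.

Lemma V_fix (i x j : 'I_n) k : j != i -> (V i ^+ k)%g (pos x j) = pos x j.
Proof.
by move=> ji; rewrite permX iter_fix // cycle_perm_out // mem_col_seq.
Qed.

Lemma H_fix (i x j : 'I_n) k : x != i -> (H i ^+ k)%g (pos x j) = pos x j.
Proof.
by move=> xi; rewrite permX iter_fix // cycle_perm_out // mem_row_seq.
Qed.

Lemma V_trans (i x y : 'I_n) : exists k, (V i ^+ k)%g (pos x i) = pos y i.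
Proof. by apply: cycle_perm_trans; rewrite mem_col_seq. Qed.

Lemma H_trans (i x y : 'I_n) : exists k, (H i ^+ k)%g (pos i x) = pos i y.
Proof. by apply: cycle_perm_trans; rewrite mem_row_seq. Qed.

Lemma V_neq (i x : 'I_n) : 1 < n -> V i (pos x i) != pos x i.
Proof.
move=> n_gt1; have [y yx] : exists y, y != x.
  have : 0 < #|~: [set x]| by rewrite cardsC1 card_ord -subn1 subn_gt0.
  by case/card_gt0P => y; rewrite !inE; exists y.
apply: contra yx => /eqP fixV; have [k] := V_trans i x y.
by rewrite permX iter_fix // => /pos_inj[->].
Qed.

Lemma H_neq (i x : 'I_n) : 1 < n -> H i (pos i x) != pos i x.
Proof.
move=> n_gt1; have [y yx] : exists y, y != x.
  have : 0 < #|~: [set x]| by rewrite cardsC1 card_ord -subn1 subn_gt0.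
  by case/card_gt0P => y; rewrite !inE; exists y.
apply: contra yx => /eqP fixH; have [k] := H_trans i x y.
by rewrite permX iter_fix // => /pos_inj[_ ->].
Qed.

Lemma V_col (i x : 'I_n) : exists y, V i (pos x i) = pos y i.
Proof.
have [y [j E]] := posP (V i (pos x i)); exists y; rewrite E; congr pos.
by apply/eqP; rewrite -(mem_col_seq i y) -E cycle_permE mem_next mem_col_seq.
Qed.

Lemma H_row (i x : 'I_n) : exists y, H i (pos i x) = pos i y.
Proof.
have [j [y E]] := posP (H i (pos i x)); exists y; rewrite E; congr pos.
by apply/eqP; rewrite -(mem_row_seq i j y) -E cycle_permE mem_next mem_row_seq.
Qed.

(** The commutator of H_o and V_o gives a 3-cycle through the corner p = (o, o),
a position (a, o) of its column and a position (o, b) of its row. Lines that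
avoid the first two points carry the third one: along column b to all (i, b),
then along the rows other than o and a, then along the columns other than o,
which reaches every position but the two fixed ones. *)
Lemma Alt_sub_magic : 1 < n -> ('Alt_(board n) \subset magic_group n)%g.
Proof.
move=> n_gt1; pose o : 'I_n := Ordinal (ltnW n_gt1); pose p := pos o o.
have [a Ea] := V_col o o; have [b Eb] := H_row o o.
have ao : a != o.
  by apply: contra (V_neq o o n_gt1) => /eqP ao; rewrite Ea ao.
have bo : b != o.
  by apply: contra (H_neq o o n_gt1) => /eqP bo; rewrite Eb bo.
pose c z := (tperm p (pos a o) * tperm p z)%g.
have cJ z g : g \in magic_group n -> g p = p -> g (pos a o) = pos a o ->
    c z \in magic_group n -> c (g z) \in magic_group n.
  move=> Gg gp ga Gc; suff -> : c (g z) = (c z ^ g)%g by apply: groupJ.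
  by rewrite /c conjMg !tpermJ gp ga.
have cVk z i k : i != o ->
    c z \in magic_group n -> c ((V i ^+ k)%g z) \in magic_group n.
  by move=> io; apply: cJ; rewrite ?groupX ?V_magic // V_fix // eq_sym.
have cHk z i k : i != o -> i != a ->
    c z \in magic_group n -> c ((H i ^+ k)%g z) \in magic_group n.
  by move=> io ia; apply: cJ; rewrite ?groupX ?H_magic // H_fix // eq_sym.
have c0 : c (pos o b) \in magic_group n.
  rewrite /c -Ea -Eb -(commg_three_cycle (cycle_perm_on _) (cycle_perm_on _)).
  - by rewrite groupR ?V_magic ?H_magic.
  - apply/subsetP => z; have [x [y ->]] := posP z.
    by rewrite !inE mem_col_seq mem_row_seq => /andP[/eqP-> /eqP->].
  - exact: H_neq.
  exact: V_neq.
have cb i : c (pos i b) \in magic_group n.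
  by have [k <-] := V_trans b o i; apply: cVk.
have cH i j : i != o -> i != a -> c (pos i j) \in magic_group n.
  by have [k <-] := H_trans i b j; move=> io ia; apply: cHk.
apply: (@Alt_sub_three_cycles _ _ p (pos a o)).
  by apply: contra ao => /eqP/pos_inj[->].
move=> z; have [i [j ->]] := posP z => zp za; rewrite -/(c (pos i j)).
have [->//|jb] := eqVneq j b.
have [jo|jo] := eqVneq j o.
  by apply: cH; [apply: contra zp | apply: contra za] => /eqP ->; rewrite jo.
(* Only rows o and a are left, away from columns o and b. Then o, b and j are
   three different indices, so that a row other than o and a exists. *)
have [i' i'oa] : exists i' : 'I_n, i' \notin [set o; a].
  have n_gt2 : 2 < n.
    have : #|[set o; b; j]| = 3.
      rewrite -setUA cardsU1 cards2 !inE eq_sym (negPf bo).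
      by rewrite eq_sym (negPf jo) eq_sym jb.
    by move=> <-; rewrite -[X in _ <= X](card_ord n) max_card.
  have : 0 < #|~: [set o; a]|.
    rewrite cardsCs setCK card_ord subn_gt0 cards2 (leq_ltn_trans _ n_gt2) //.
    by case: (_ != _).
  by case/card_gt0P => i'; rewrite inE; exists i'.
move: i'oa; rewrite !inE negb_or => /andP[i'o i'a].
by have [k <-] := V_trans j i' i; apply/cVk/cH.
Qed.

Lemma card_magic_group : 1 < n -> (n ^ 2)`! <= (odd n).+1 * #|magic_group n|.
Proof.
move=> n_gt1; have sAG := Alt_sub_magic n_gt1.
have n2_gt1 : 1 < #|board n| by rewrite card_ord (@ltn_exp2l n 0).
suff: #|board n|`! <= (odd n).+1 * #|magic_group n| by rewrite card_ord.
case: (boolP (odd n)) => n_odd.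
  by rewrite -card_Alt // leq_mul2l subset_leq_card.
rewrite mul1n; apply: card_ge_Alt_odd => //.
exists (V (Ordinal n_gt1)); first exact: V_magic.
rewrite odd_cycle_perm size_col_seq.
by case: n n_gt1 n_odd => //= m _; rewrite negbK.
Qed.

End MagicGroup.

(** * Counting alternating products *)

(** Recursion on all earlier values: [history k] lists the values at
k - 1, ..., 0, each computed once, which keeps the evaluation of the counts
polynomial. The sets of products follow the same recursion as their counts. *)
Section CourseOfValues.

Variables (A : Type) (F : seq A -> A).

Fixpoint history k : seq A :=
  if k is k'.+1 then let s := history k' in F s :: s else [::].

Definition value k := F (history k).

Lemma size_history k : size (history k) = k.
Proof. by elim: k => //= k ->. Qed.

Lemma nth_history x0 k i : i < k -> nth x0 (history k) i = value (k - i.+1).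
Proof.
by elim: k i => // k IHk [|i] ik; rewrite subSS ?subn0 //= IHk.
Qed.

End CourseOfValues.

Definition sumN (f : nat -> N) (r : seq nat) : N :=
  foldr (fun i acc => f i + acc)%num 0%num r.

Lemma sumNE f r : N.to_nat (sumN f r) = \sum_(i <- r) N.to_nat (f i).
Proof.
elim: r => [|i r IHr]; first by rewrite big_nil.
by rewrite big_cons -IHr /= Nnat.N2Nat.inj_add.
Qed.

(** Here n is the number of lines of a kind, and q the number of shifts of a
line other than the identity. *)
Section WordCount.

Variables n q : nat.

Definition block_count w : N :=
  (N.of_nat 'C(n, w) * iter w (N.mul (N.of_nat q)) 1)%num.

Definition word_count_step (s : seq N) : N :=
  if s is [::] then 1%num else
    sumN (fun i => block_count i.+1 * nth 0 s i)%num (iota 0 (size s)).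

Definition word_count : nat -> N := value word_count_step.

Definition ball_count k : N :=
  (1 + 2 * sumN (fun m => word_count m.+1) (iota 0 k))%num.

Lemma block_countE w : N.to_nat (block_count w) = 'C(n, w) * q ^ w.
Proof.
rewrite /block_count Nnat.N2Nat.inj_mul Nnat.Nat2N.id; congr (_ * _).
by elim: w => //= w IHw; rewrite Nnat.N2Nat.inj_mul Nnat.Nat2N.id IHw expnS.
Qed.

Lemma word_countS m :
  N.to_nat (word_count m.+1) =
    \sum_(i < m.+1) 'C(n, i.+1) * q ^ i.+1 * N.to_nat (word_count (m - i)).
Proof.
pose s := history word_count_step m.+1.
have -> : word_count m.+1 =
  sumN (fun i => block_count i.+1 * nth 0 s i)%num (iota 0 (size s)) by [].
rewrite sumNE size_history -[iota 0 _]/(index_iota 0 m.+1) big_mkord.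
by apply: eq_bigr => i _; rewrite Nnat.N2Nat.inj_mul block_countE nth_history.
Qed.

Lemma ball_countE k :
  N.to_nat (ball_count k) = 1 + 2 * \sum_(m < k) N.to_nat (word_count m.+1).
Proof.
rewrite Nnat.N2Nat.inj_add Nnat.N2Nat.inj_mul sumNE.
by rewrite -[k in iota 0 k]subn0 -/(index_iota 0 k) big_mkord.
Qed.

End WordCount.

Section AlternatingWords.

Local Open Scope group_scope.

Variable gT : finGroupType.

(** The products of exactly w nontrivial factors, taken from w different groups
of r in the order of r. *)
Fixpoint blocks (r : seq {group gT}) (w : nat) : {set gT} :=
  match r, w with
  | [::], 0 => 1
  | [::], _.+1 => set0
  | A :: r', 0 => blocks r' 0
  | A :: r', w'.+1 => blocks r' w'.+1 :|: A^# * blocks r' w'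
  end.

Lemma card_mulg_leq (A B : {set gT}) : (#|(A * B)%g| <= #|A| * #|B|)%N.
Proof.
by rewrite /mulg /= /set_mulg curry_imset2X -cardsX leq_imset_card.
Qed.

Lemma blocks0 r : blocks r 0 = 1.
Proof. by elim: r. Qed.

Lemma card_blocks (q : nat) r w :
    (forall A : {group gT}, A \in r -> #|A| <= q.+1)%N ->
  (#|blocks r w| <= 'C(size r, w) * q ^ w)%N.
Proof.
elim: r w => [|A r IHr] [|w] le_q; rewrite ?blocks0 ?cards0 ?cards1 ?bin0 //=.
have {}IHr w' : (#|blocks r w'| <= 'C(size r, w') * q ^ w')%N.
  by apply: IHr => B rB; apply: le_q; rewrite inE rB orbT.
rewrite binS mulnDl; apply: leq_trans (leq_card_setU _ _) _.
apply: leq_add; first exact: IHr.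
apply: leq_trans (card_mulg_leq _ _) _; rewrite expnS mulnCA leq_mul //.
by have := le_q A (mem_head _ _); rewrite (cardsD1 1) group1.
Qed.

(** A factor from a group of r is moved past the others until it meets the
factor from the same group, if any, and is merged with it. *)
Lemma blocks_mull r (A : {group gT}) w z u :
    (forall B C : {group gT}, B \in r -> C \in r -> B \subset 'C(C)) ->
    A \in r -> z \in A -> u \in blocks r w ->
  exists2 w', (w' <= w.+1)%N & z * u \in blocks r w'.
Proof.
elim: r w u => // B r IHr w u cr; rewrite inE => Ar Az.
have cBr C D : C \in r -> D \in r -> C \subset 'C(D).
  by move=> rC rD; apply: cr; rewrite inE ?rC ?rD orbT.
have [EA|AB] := eqVneq A B.
  rewrite EA in Az.
  case: w => [|w] /= Bu.
    have [->|z1] := eqVneq z 1; first by exists 0%N; rewrite ?mul1g.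
    exists 1%N => //=; rewrite inE; apply/orP; right.
    by rewrite mem_mulg // !inE z1.
  case/setUP: Bu => [ru|].
    have [->|z1] := eqVneq z 1.
      by exists w.+1; rewrite // mul1g /= inE ru.
    exists w.+2 => //=; rewrite inE; apply/orP; right.
    by rewrite mem_mulg // !inE z1.
  case/mulsgP=> a v /setD1P[_ Ba] rv ->; rewrite mulgA.
  have [->|za1] := eqVneq (z * a) 1.
    exists w; first by rewrite (leq_trans (leqnSn _)).
    by rewrite mul1g; case: w rv => [|w] //= rv; rewrite inE rv.
  exists w.+1 => //=; rewrite inE; apply/orP; right.
  by rewrite mem_mulg // !inE za1 groupM.
rewrite (negPf AB) /= in Ar.
have shift w' v : v \in blocks r w' -> v \in blocks (B :: r) w'.
  by case: w' => //= w'; rewrite inE => ->.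
case: w => [|w] /= Bu.
  by have [w' le_w' /shift] := IHr _ _ cBr Ar Az Bu; exists w'.
case/setUP: Bu => [ru|].
  by have [w' le_w' /shift] := IHr _ _ cBr Ar Az ru; exists w'.
case/mulsgP=> a v Ba rv ->; have [w' le_w' rzv] := IHr _ _ cBr Ar Az rv.
exists w'.+1 => //=; rewrite inE; apply/orP; right.
have cza : commute z a.
  apply: (centP (subsetP (cr A B _ _) z Az)); rewrite ?inE ?Ar ?eqxx ?orbT //.
  by case/setD1P: Ba.
by rewrite mulgA cza -mulgA mem_mulg.
Qed.

(** The two kinds of lines are told apart by a boolean. *)
Variable r : bool -> seq {group gT}.

Definition words_step (s : seq (bool -> {set gT})) (b : bool) : {set gT} :=
  if s is [::] then 1 else
    \bigcup_(i < size s) (blocks (r b) i.+1 * nth (fun=> set0) s i (~~ b)).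

(** [words m b] consists of the alternating products of blocks of total size m
whose first block is of kind b. *)
Definition words : nat -> bool -> {set gT} := value words_step.

Lemma wordsS m b :
  words m.+1 b =
    \bigcup_(i < m.+1) (blocks (r b) i.+1 * words (m - i) (~~ b)).
Proof.
pose s := history words_step m.+1.
have -> : words m.+1 b =
  \bigcup_(i < size s) (blocks (r b) i.+1 * nth (fun=> set0) s i (~~ b)) by [].
by rewrite size_history; apply: eq_bigr => i _; rewrite nth_history.
Qed.

(** The alternating products of total at most k; the trivial one belongs to both
kinds and is listed once. *)
Definition ball k : {set gT} :=
  1 :|: \bigcup_(m < k) (words m.+1 true :|: words m.+1 false).

Lemma ballP k x :
  reflect (exists b m, (m <= k)%N /\ x \in words m b) (x \in ball k).
Proof.
apply: (iffP setUP) => [[x1|/bigcupP[m _]]|[b [[|m] [mk]]]].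
- by exists true, 0%N.
- by case/setUP => xm; [exists true | exists false]; exists m.+1.
- by left.
by move=> xm; right; apply/bigcupP; exists (Ordinal mk) => //; case: b xm => xm;
   rewrite inE xm ?orbT.
Qed.

Hypothesis cr :
  forall b (A B : {group gT}), A \in r b -> B \in r b -> A \subset 'C(B).

(** Any alternating product starts with a block of the prescribed kind c,
provided that this block may be empty. *)
Lemma words_split c b m x : x \in words m b ->
  exists w m' u v, [/\ (w + m' = m)%N, u \in blocks (r c) w,
    v \in words m' (~~ c) & x = u * v].
Proof.
have [-> {b}|bc] := eqVneq b c; last first.
  move=> xm; exists 0%N, m, 1, x; rewrite blocks0 set11 mul1g; split=> //.
  by case: b c bc xm => [] [].
case: m => [|m].
  by move=> x1; exists 0%N, 0%N, 1, x; rewrite blocks0 set11 mul1g.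
rewrite wordsS => /bigcupP[i _ /mulsgP[u v ru rv ->]].
by exists i.+1, (m - i)%N, u, v; split; rewrite // addSn subnKC // -ltnS.
Qed.

Lemma ball_mull k c (A : {group gT}) z x :
  A \in r c -> z \in A -> x \in ball k -> z * x \in ball k.+1.
Proof.
move=> rA Az /ballP[b [m [mk /(words_split c)[w [m' [u [v [wm ru rv ->]]]]]]]].
have [[|w'] w'w rzu] := blocks_mull (@cr c) rA Az ru; apply/ballP.
  (* the first block merged with z is trivial and disappears *)
  exists (~~ c), m'; split.
    by rewrite ltnW // ltnS (leq_trans _ mk) // -wm leq_addl.
  by move: rzu; rewrite mulgA blocks0 => /set1P ->; rewrite mul1g.
exists c, (w'.+1 + m')%N; split.
  by rewrite (leq_trans (leq_add w'w (leqnn m'))) // addSn wm.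
rewrite addSn wordsS; apply/bigcupP.
exists (Ordinal (leq_addr m' w' : w' < (w' + m').+1)%N) => //=.
by rewrite addKn mulgA mem_mulg.
Qed.

Lemma card_words n q m b :
    (forall b, size (r b) = n) ->
    (forall b (A : {group gT}), A \in r b -> #|A| <= q.+1)%N ->
  (#|words m b| <= N.to_nat (word_count n q m))%N.
Proof.
move=> size_r card_r; elim/ltn_ind: m b => [[|m]] IHm b.
  by rewrite cards1.
rewrite wordsS word_countS; elim/big_ind2: _ => [|X1 k1 X2 k2 le1 le2|i _].
- by rewrite cards0.
- by apply: leq_trans (leq_card_setU _ _) _; apply: leq_add.
apply: leq_trans (card_mulg_leq _ _) _; apply: leq_mul.
  by rewrite -(size_r b); apply: card_blocks => A; apply: card_r.
by apply: IHm; rewrite ltnS leq_subr.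
Qed.

Lemma card_ball n q k :
    (forall b, size (r b) = n) ->
    (forall b (A : {group gT}), A \in r b -> #|A| <= q.+1)%N ->
  (#|ball k| <= N.to_nat (ball_count n q k))%N.
Proof.
move=> size_r card_r; rewrite ball_countE.
apply: leq_trans (leq_card_setU _ _) _; rewrite cards1 leq_add2l big_distrr /=.
elim/big_ind2: _ => [|X1 k1 X2 k2 le1 le2|m _].
- by rewrite cards0.
- by apply: leq_trans (leq_card_setU _ _) _; apply: leq_add.
apply: leq_trans (leq_card_setU _ _) _.
by rewrite mul2n -addnn leq_add ?(card_words _ _ size_r card_r).
Qed.

End AlternatingWords.

(** * Short products and the diameter *)

Section Diameter.

Lemma walk_diameter (T : finType) (e : rel T) x y :
  connect e x y -> exists2 k, k <= diameter e & walk e x y k.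
Proof.
move=> exy; exists (gdist e x y).
  by apply: leq_trans (leq_bigmax x); apply: (leq_bigmax y).
by rewrite /gdist; case: {-}_ / idP => // exy'; case: ex_minnP.
Qed.

Variable n : nat.

Definition lines (b : bool) : seq {group {perm board n}} :=
  [seq <[if b then V i else H i]>%G | i <- enum 'I_n].

Lemma size_lines b : size (lines b) = n.
Proof. by rewrite size_map size_enum_ord. Qed.

Lemma card_lines b (A : {group {perm board n}}) :
  1 < n -> A \in lines b -> #|A| <= n.-1.+1.
Proof.
move=> n_gt1 /mapP[i _ ->]; rewrite (prednK (ltnW n_gt1)).
case: b => /=.
  rewrite -[X in _ <= X](size_col_seq i) /V card_cycle_perm //.
  by rewrite size_col_seq ltnW.
rewrite -[X in _ <= X](size_row_seq i) /H card_cycle_perm //.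
by rewrite size_row_seq ltnW.
Qed.

Lemma lines_cent b (A B : {group {perm board n}}) :
  A \in lines b -> B \in lines b -> A \subset 'C(B)%g.
Proof.
move=> /mapP[i _ ->] /mapP[j _ ->]; rewrite cycle_subG.
apply/centP => _ /cycleP[k ->]; apply: commuteX; have [-> //|ij] := eqVneq i j.
case: b; apply: perm_onC (cycle_perm_on _) (cycle_perm_on _) _;
  apply/pred0P => z; have [x [y ->]] := posP z; rewrite /= !inE.
  by rewrite !mem_col_seq; case: eqP => // ->; rewrite (negPf ij).
by rewrite !mem_row_seq; case: eqP => // ->; rewrite (negPf ij).
Qed.

Lemma cayley_lines (G : {group {perm board n}}) (x y : subg_of G) :
    cayley G (magic_gens n) x y ->
  exists b (A : {group {perm board n}}) z,
    [/\ A \in lines b, z \in A & sgval y = (z * sgval x)%g].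
Proof.
case/existsP => g /andP[]; rewrite inE.
move=> /existsP[i /existsP[j /andP[_ gVH]]] yx.
pose A b := <[if b then V i else H i]>%G.
have [b Ag] : exists b, g \in A b.
  by case/orP: gVH => /eqP->; [exists true | exists false]; rewrite mem_cycle.
have Ab : A b \in lines b by apply: map_f; rewrite mem_enum.
case/orP: yx => /eqP Exy; exists b, (A b).
  by exists g.
by exists g^-1%g; rewrite groupV Exy mulKg.
Qed.

Lemma path_ball (G : {group {perm board n}}) k (x : subg_of G) p :
  path (cayley G (magic_gens n)) x p -> sgval x \in ball lines k ->
  sgval (last x p) \in ball lines (k + size p).
Proof.
elim: p k x => [|y p IHp] k x /=; first by rewrite addn0.
case/andP=> /cayley_lines[b [A [z [lA Az Ey]]]] yp xk.
rewrite addnS -addSn; apply: IHp => //; rewrite Ey.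
exact: (ball_mull lines_cent lA Az xk).
Qed.

Lemma ball_diameter : 1 < n ->
  magic_group n \subset
    ball lines (diameter (cayley (magic_group n) (magic_gens n))).
Proof.
move=> n_gt1; apply/subsetP => g Gg; set e := cayley _ _.
have [k le_k] := walk_diameter
  (cayley_connected (magic_gens_generate n_gt1) 1%g (subg _ g)).
case/existsP => p /andP[/path_ball pb /eqP lastp].
have : g \in ball lines k.
  have <- : sgval (subg (magic_group n) g) = g by rewrite subgK.
  rewrite -lastp -[X in ball _ X](size_tuple p) -[size p]add0n.
  by apply: pb; rewrite inE set11.
case/ballP => b [m [mk gm]]; apply/ballP; exists b, m.
by split=> //; apply: leq_trans le_k.
Qed.

Lemma diameter_gt k : 1 < n ->
    (odd n).+1 * N.to_nat (ball_count n n.-1 k) < (n ^ 2)`! ->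
  k < diameter (cayley (magic_group n) (magic_gens n)).
Proof.
move=> n_gt1; apply: contraTltn => le_k; rewrite -leqNgt.
apply: leq_trans (card_magic_group n_gt1) _; rewrite leq_mul2l /=.
have le_ball := card_ball k size_lines (fun b A => @card_lines b A n_gt1).
apply: leq_trans le_ball; apply: subset_leq_card.
apply: subset_trans (ball_diameter n_gt1) _.
apply/subsetP => g /ballP[b [m [mk gm]]]; apply/ballP; exists b, m.
by split=> //; apply: leq_trans le_k.
Qed.

End Diameter.

Fixpoint factN k : N :=
  if k is k'.+1 then (N.of_nat k * factN k')%num else 1%num.

Lemma factNE k : N.to_nat (factN k) = k`!.
Proof.
by elim: k => // k IHk; rewrite Nnat.N2Nat.inj_mul Nnat.Nat2N.id IHk factS.
Qed.

Lemma diameter_gt_test n k :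
    (1 < n) &&
    (N.of_nat (odd n).+1 * ball_count n n.-1 k <? factN (n ^ 2))%num ->
  k < diameter (cayley (magic_group n) (magic_gens n)).
Proof.
case/andP=> n_gt1 /N.ltb_lt lt_count; apply: diameter_gt => //; rewrite -factNE.
set m := (odd n).+1 in lt_count *; set c := ball_count _ _ _ in lt_count *.
have -> : m * N.to_nat c = N.to_nat (N.of_nat m * c)%num.
  by rewrite Nnat.N2Nat.inj_mul Nnat.Nat2N.id.
by apply/ltP; lia.
Qed.

Theorem mainTheorem4 :
     3 <= diameter (cayley (magic_group 2) (magic_gens 2))
  /\ 6 <= diameter (cayley (magic_group 3) (magic_gens 3))
  /\ 11 <= diameter (cayley (magic_group 4) (magic_gens 4))
  /\ 18 <= diameter (cayley (magic_group 5) (magic_gens 5))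
  /\ 26 <= diameter (cayley (magic_group 6) (magic_gens 6))
  /\ 36 <= diameter (cayley (magic_group 7) (magic_gens 7))
  /\ 48 <= diameter (cayley (magic_group 8) (magic_gens 8)).
Proof.
split; first by apply: (@diameter_gt_test 2 2); vm_compute.
split; first by apply: (@diameter_gt_test 3 5); vm_compute.
split; first by apply: (@diameter_gt_test 4 10); vm_compute.
split; first by apply: (@diameter_gt_test 5 17); vm_compute.
split; first by apply: (@diameter_gt_test 6 25); vm_compute.
split; first by apply: (@diameter_gt_test 7 35); vm_compute.
by apply: (@diameter_gt_test 8 47); vm_compute.
Qed.
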